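(* Let $H=(V,E)$ be a connected hypergraph without empty edges, with $|V|\ge 2$ and $v\in V$. (1) If $v$ is a cut vertex of $H$, then $v$ is a separating vertex of $H$. (2) If $v$ is a separating vertex of $H$ and $\{v\}\notin E$, then $v$ is a cut vertex of $H$.
   Context: A hypergraph $H=(V,E)$ consists of a nonempty finite vertex set $V$, a finite edge set $E$, and an incidence function $\psi:E\to 2^V$; edges are identified with their vertex sets (parallel edges allowed); an empty edge has empty vertex set; $\{v\}\notin E$ means no edge has vertex set $\{v\}$. Two distinct vertices are adjacent via $e$ if both lie in $e$; a walk is a sequence $v_0e_1v_1\dots e_kv_k$ with $v_{i-1},v_i$ adjacent via $e_i$; $H$ is connected if any two distinct vertices are joined by a walk. For an equivalence class $V'$ of ''joined by a walk'', the connected component is $(V',\{f\in E:\emptyset\ne f\subseteq V'\})$; $\omega(H)$ is the number of components. $H\backslash v$ has vertex set $V\setminus\{v\}$ and edges $e\setminus\{v\}$ for all $e\in E$ with $e\setminus\{v\}\ne\emptyset$; $v$ is a cut vertex if $\omega(H\backslash v)>\omega(H)$. A hypersubgraph of $H$ is a hypergraph $(V',E')$ with $V'\subseteq V$, $E'\subseteq E$ (same incidence). A vertex $v$ is a separating vertex of $H$ if there are two connected hypersubgraphs $H_1,H_2$ of $H$, each with at least one edge, such that $E(H_1)\cap E(H_2)=\emptyset$, $H=H_1\cup H_2$ (i.e. $V=V(H_1)\cup V(H_2)$, $E=E(H_1)\cup E(H_2)$), and $V(H_1)\cap V(H_2)=\{v\}$. *)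

(* Defs.v *)
From mathcomp Require Import all_boot.

Set Implicit Arguments.
Unset Strict Implicit.
Unset Printing Implicit Defensive.

(* The vertices and the edges are finite subsets of ambient finite types T and
   I, so that a hypergraph, its hypersubgraphs and its vertex deletions all live
   in one type.  Edges are names in I (hence parallel edges and empty edges are
   allowed); the values of inc outside eset carry no meaning. *)
Record hypergraph (T I : finType) := Hypergraph {
  vset : {set T};
  eset : {set I};
  inc : I -> {set T};
  vset_neq0 : vset != set0;
  inc_sub : forall e, e \in eset -> inc e \subset vset
}.

Section Hypergraphs.
Variables T I : finType.
Implicit Types (H K : hypergraph T I) (e : I) (u v : T).

Definition adjacent_via H e u v :=
  [&& e \in eset H, u != v, u \in inc H e & v \in inc H e].

(* [:: (e_1, v_1); ...; (e_k, v_k)] encodes v_0 e_1 v_1 ... e_k v_k, where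
   v_0 = u. *)
Fixpoint walk H u (w : seq (I * T)) : bool :=
  if w is (e, x) :: w' then adjacent_via H e u x && walk H x w'
  else u \in vset H.

Definition adjacent H u v := [exists e, adjacent_via H e u v].

Definition joined H : rel T := connect (adjacent H).

Lemma adjacent_via_vset H e u v : adjacent_via H e u v -> v \in vset H.
Proof. by case/and4P=> eH _ _; apply: subsetP (inc_sub eH) _. Qed.

Lemma joinedP H u v : u \in vset H ->
  reflect (exists2 w, walk H u w & v = last u (unzip2 w)) (joined H u v).
Proof.
move=> uH; apply: (iffP connectP) => [[p]|[w]].
  elim: p u uH => [|x p IHp] u uH /= => [_ ->|/andP[/existsP[e a_ux] p_x] Dv].
    by exists [::].
  have [w w_x ->] := IHp x (adjacent_via_vset a_ux) p_x Dv.
  by exists ((e, x) :: w) => //=; rewrite a_ux.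
move=> + ->; elim: w u {uH} => [|[e x] w IHw] u /= => [_|/andP[a_ux w_x]].
  by exists [::].
have [p p_x ->] := IHw x w_x; exists (x :: p) => //=.
by rewrite p_x andbT; apply/existsP; exists e.
Qed.

Definition connected H : Prop :=
  forall u v, u \in vset H -> v \in vset H -> u != v -> joined H u v.

(* A connected component, given by its vertex set and its edge set. *)
Definition components H : {set {set T} * {set I}} :=
  [set (C, [set f in eset H | (inc H f != set0) && (inc H f \subset C)])
     | C : {set T} in equivalence_partition (joined H) (vset H)].

Definition omega H : nat := #|components H|.

Section Deletion.
Variables (H : hypergraph T I) (v : T).
(* Since a hypergraph has a vertex, H \ v exists only if H has another one. *)
Hypothesis gt1 : 1 < #|vset H|.

Fact del_vset_neq0 : vset H :\ v != set0.
Proof.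
rewrite -card_gt0; move: gt1; rewrite (cardsD1 v).
by case: (v \in vset H) => // /ltnW.
Qed.

Fact del_inc_sub e : e \in [set f in eset H | inc H f :\ v != set0] ->
  inc H e :\ v \subset vset H :\ v.
Proof. by rewrite inE => /andP[eH _]; apply/setSD/inc_sub. Qed.

Definition del_vertex : hypergraph T I := Hypergraph del_vset_neq0 del_inc_sub.

Definition cut_vertex : Prop := omega H < omega del_vertex.

End Deletion.

Definition hypersubgraph K H : Prop :=
  [/\ vset K \subset vset H, eset K \subset eset H
    & {in eset K, inc K =1 inc H}].

Definition separating_vertex H v : Prop :=
  exists H1 H2 : hypergraph T I,
    [/\ hypersubgraph H1 H /\ hypersubgraph H2 H,
        connected H1 /\ connected H2,
        eset H1 != set0 /\ eset H2 != set0,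
        eset H1 :&: eset H2 = set0
      & [/\ vset H = vset H1 :|: vset H2,
            eset H = eset H1 :|: eset H2
          & vset H1 :&: vset H2 = [set v]]].

End Hypergraphs.

(* Main.v *)
(* A connected H has exactly one component, so v is a cut vertex iff H \ v has
   two vertices x, y that are not joined.  Given such x, the component C of x in
   H \ v splits H at v into the part spanned by v |: C with the edges meeting C
   and the part spanned by the other vertices with the other edges; both are
   connected because a path of H towards v, followed until it first reaches v,
   stays in its part.  Conversely, for a splitting V1, V2 at v, every edge of
   H \ v lies within V1 or within V2, and as {v} is not an edge both sides have
   a vertex other than v. *)
Require Import Defs.
From mathcomp Require Import all_boot.

Section Components.
Set Implicit Arguments.
Unset Strict Implicit.
Variables T I : finType.
Implicit Types (H K : hypergraph T I) (u v x y : T).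

Lemma adjacent_sym H : symmetric (adjacent H).
Proof.
move=> u x; apply/existsP/existsP => -[e /and4P[eH ne ue xe]];
  by exists e; rewrite /adjacent_via eH eq_sym ne xe ue.
Qed.

Lemma joined_sym H : symmetric (joined H).
Proof. exact: sym_connect_sym (@adjacent_sym H). Qed.

Lemma joined_equiv H : {in vset H & &, equivalence_rel (joined H)}.
Proof.
move=> x y z _ _ _; split=> [|xy]; first exact: connect0.
exact: same_connect (sym_connect_sym (@adjacent_sym H)) _ _ xy z.
Qed.

Lemma mem_edge_joined H e x y :
  e \in eset H -> x \in inc H e -> y \in inc H e -> joined H x y.
Proof.
move=> eH xe ye; have [->|ne] := eqVneq x y; first exact: connect0.
by apply/connect1/existsP; exists e; rewrite /adjacent_via eH ne xe.
Qed.

(** Induction along the walk: each edge used contains the current vertex, which is in [A], so the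
    whole edge lies inside [A]. *)
Lemma joined_closed H (A : {set T}) x y :
  (forall e, e \in eset H -> ~~ [disjoint inc H e & A] -> inc H e \subset A) ->
  x \in A -> joined H x y -> y \in A.
Proof.
move=> clA xA /connectP[p + ->]; elim: p x xA => //= z p IHp x xA.
case/andP=> /existsP[e /and4P[eH _ xe ze]] pz; apply: IHp pz.
by apply: subsetP (clA e eH _) z ze; apply/pred0Pn; exists x; apply/andP.
Qed.

(** The first entry of a component is its class, so attaching the edges to a class is injective. *)
Lemma omega_classes H :
  omega H = #|equivalence_partition (joined H) (vset H)|.
Proof. by rewrite /omega card_imset // => A B []. Qed.

Lemma omega_gt0 H : 0 < omega H.
Proof.
rewrite omega_classes; have /set0Pn[x xH] := vset_neq0 H.
by apply/card_gt0P; eexists; apply: imset_f xH.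
Qed.

Lemma omega_gt1P H :
  reflect (exists x y, [/\ x \in vset H, y \in vset H & ~~ joined H x y])
          (1 < omega H).
Proof.
rewrite omega_classes; apply: (iffP card_gt1P).
  case=> _ [_ [/imsetP[x xH ->] /imsetP[y yH ->] ne]]; exists x, y; split=> //.
  apply: contra ne => xy; apply/eqP/setP=> z; rewrite !inE.
  by case: (boolP (z \in vset H)) => //= zH; apply: (joined_equiv xH yH zH).2.
case=> x [y [xH yH nxy]]; do 2!eexists; split; [exact: imset_f xH | exact: imset_f yH |].
apply: contra nxy => /eqP/setP/(_ y); rewrite !inE yH /= => ->.
exact: connect0.
Qed.

Lemma connected_omega_le1 H : connected H -> omega H <= 1.
Proof.
move=> cH; rewrite leqNgt; apply/omega_gt1P => -[x [y [xH yH /negP[]]]].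
have [->|] := eqVneq x y; [exact: connect0 | exact: cH].
Qed.

(** Every vertex of [K] is joined to [v] inside [K]: until the walk in [H] reaches [v], its current
    vertex lies in [K] off [v], which forces the next edge into [K]. *)
Lemma hypersubgraph_connected H K v :
  connected H -> hypersubgraph K H -> v \in vset K ->
  (forall e, e \in eset H -> ~~ [disjoint inc H e & vset K :\ v] ->
     e \in eset K) ->
  connected K.
Proof.
move=> cH [sV sE incE] vK clK.
have to_v x : x \in vset K -> joined K x v.
  move=> xK; have [->|nxv] := eqVneq x v; first exact: connect0.
  have /connectP[p] := cH x v (subsetP sV x xK) (subsetP sV v vK) nxv.
  elim: p x {nxv} xK => [|z p IHp] x xK /=; first by move=> _ ->; apply: connect0.
  have [->|nxv] := eqVneq x v; first by move=> _ _; apply: connect0.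
  case/andP=> /existsP[e /and4P[eH _ xe ze]] pz Dv.
  have eK : e \in eset K.
    by apply: clK eH _; apply/pred0Pn; exists x; rewrite /= xe !inE nxv.
  have zK : z \in vset K by apply: (subsetP (inc_sub eK)); rewrite incE.
  apply: connect_trans (IHp z zK pz Dv).
  by apply: (mem_edge_joined eK); rewrite incE.
move=> x y xK yK _; apply: connect_trans (to_v x xK) _.
by rewrite -/(joined K v y) joined_sym to_v.
Qed.

Lemma connected_eset_neq0 H x y :
  connected H -> x \in vset H -> y \in vset H -> x != y -> eset H != set0.
Proof.
move=> cH xH yH nxy; have /connectP[[|z p]] := cH x y xH yH nxy.
  by move=> _ Dy; rewrite Dy eqxx in nxy.
by case/andP=> /existsP[e /and4P[eH _ _ _]] _ _; apply/set0Pn; exists e.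
Qed.

(** The last hypothesis makes [C] a union of components of [H] minus [v]; [x] and [y] ensure that
    each side has a vertex besides [v], hence an edge. *)
Lemma separating_split H v (C : {set T}) x y :
  connected H -> v \in vset H -> C \subset vset H :\ v -> x \in C ->
  y \in vset H :\ v -> y \notin C ->
  (forall e, e \in eset H -> ~~ [disjoint inc H e & C] ->
     inc H e \subset v |: C) ->
  separating_vertex H v.
Proof.
move=> cH vH sC xC; rewrite !inE => /andP[nyv yH] nyC clC.
have vC : v \notin C by apply/negP => /(subsetP sC); rewrite !inE eqxx.
have CH z : z \in C -> z \in vset H by move/(subsetP sC); rewrite inE => /andP[].
(* Sorting edges by whether they meet [C], not by inclusion in [v |: C], sends any edge [{v}] to the
   second side only. *)
pose E1 := [set e in eset H | ~~ [disjoint inc H e & C]].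
have V1_n0 : v |: C != set0 by apply/set0Pn; exists v; apply: setU11.
have V2_n0 : vset H :\: C != set0 by apply/set0Pn; exists v; rewrite inE vC.
have sub1 e : e \in E1 -> inc H e \subset v |: C.
  by rewrite inE => /andP[]; apply: clC.
have sub2 e : e \in eset H :\: E1 -> inc H e \subset vset H :\: C.
  rewrite !inE => /andP[+ eH]; rewrite eH /= negbK => eC.
  by rewrite subsetD inc_sub.
pose H1 := Hypergraph V1_n0 sub1; pose H2 := Hypergraph V2_n0 sub2.
have sH1 : hypersubgraph H1 H.
  split=> //=; last by apply/subsetP=> e; rewrite inE => /andP[].
  by apply/subUsetP; rewrite sub1set; split=> //; apply/subsetP.
have sH2 : hypersubgraph H2 H by split=> //=; apply: subsetDl.
have vH1 : v \in vset H1 by apply: setU11.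
have vH2 : v \in vset H2 by rewrite inE vC.
have cH1 : connected H1.
  apply: (hypersubgraph_connected cH sH1 vH1) => e eH /=.
  by rewrite setU1K // inE eH.
have cH2 : connected H2.
  apply: (hypersubgraph_connected cH sH2 vH2) => e eH /pred0Pn[z].
  rewrite /= !inE eH /= negbK andbT => /and4P[ze nzv nzC _].
  apply/negPn/negP => /(clC e eH)/subsetP/(_ z ze).
  by rewrite !inE (negPf nzv) (negPf nzC).
exists H1, H2; split=> //.
- split.
    apply: connected_eset_neq0 cH1 (setU1r v xC) vH1 _.
    by apply: contraNneq vC => <-.
  by apply: connected_eset_neq0 cH2 _ vH2 nyv; rewrite inE nyC.
- by apply/setP=> e; rewrite !inE; case: (e \in eset H); case: disjoint.
split; apply/setP=> t; rewrite !inE.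
- have [->|_] := eqVneq t v; first by rewrite vH.
  by case: (boolP (t \in C)) => //= /CH ->.
- by case: (t \in eset H) => //=; case: disjoint.
have [->|_] := eqVneq t v; first by rewrite vC vH.
by case: (t \in C).
Qed.

(** The only subsets of [[set v]] are [set0] and [[set v]], both excluded as edges. *)
Lemma mem_edge_neq H v e :
  set0 \notin inc H @: eset H -> [set v] \notin inc H @: eset H ->
  e \in eset H -> exists2 x, x \in inc H e & x != v.
Proof.
move=> n0 nv eH; have eE := imset_f (inc H) eH.
have: ~~ (inc H e \subset [set v]).
  by rewrite subset1; apply/norP; split; [move: nv | move: n0];
    apply: contraNneq => <-.
by case/subsetPn=> x xe; rewrite inE; exists x.
Qed.

End Components.

Theorem theorem3p30 (T I : finType) (H : hypergraph T I) (v : T)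
    (connH : connected H)
    (noempty : set0 \notin inc H @: eset H)
    (gt1 : 2 <= #|vset H|)
    (vH : v \in vset H) :
  (cut_vertex v gt1 -> separating_vertex H v) /\
  (separating_vertex H v -> [set v] \notin inc H @: eset H -> cut_vertex v gt1).
Proof.
split=> [cut | [H1 [H2 [[[sV1 sE1 inc1] [sV2 sE2 inc2]] _ [E1n0 E2n0] _ [DV DE capV]]]] nv].
  (* As [omega H] is at least 1, deleting a cut vertex leaves at least two classes. *)
  have /omega_gt1P[x [y [xK yK nxy]]] := leq_ltn_trans (omega_gt0 H) cut.
  set K := del_vertex v gt1 in xK yK nxy.
  apply: (@separating_split _ _ H v [set z in vset K | joined K x z] x y) => //.
  - by apply/subsetP=> z; rewrite inE => /andP[].
  - by rewrite inE xK; apply: connect0.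
  - by rewrite inE (negPf nxy) andbF.
  move=> e eH /pred0Pn[z /= /andP[ze]]; rewrite inE => /andP[zK xz].
  have zv : z != v by move: zK; rewrite !inE => /andP[].
  apply/subsetP=> t te; rewrite in_setU1; have [//|ntv] /= := eqVneq t v.
  rewrite inE !inE ntv (subsetP (inc_sub eH)) //=.
  (* Removing [v] from [e] leaves an edge of [K] containing both [z] and [t]. *)
  apply: connect_trans xz (@mem_edge_joined _ _ K e _ _ _ _ _); rewrite !inE ?zv ?ntv //.
  by rewrite eH; apply/set0Pn; exists z; rewrite !inE zv.
have [e1 e1E] := set0Pn _ E1n0; have [e2 e2E] := set0Pn _ E2n0.
(* An edge of each side supplies a vertex other than [v]; these two will lie in different
   components. *)
have [x + nxv] := mem_edge_neq noempty nv (subsetP sE1 e1 e1E).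
have [y + nyv] := mem_edge_neq noempty nv (subsetP sE2 e2 e2E).
rewrite -(inc1 e1) // -(inc2 e2) // => /(subsetP (inc_sub e2E)) yV2.
move=> /(subsetP (inc_sub e1E)) xV1.
apply: leq_ltn_trans (connected_omega_le1 connH) _.
apply/omega_gt1P; exists x, y; split.
- by rewrite !inE nxv (subsetP sV1).
- by rewrite !inE nyv (subsetP sV2).
have meet z : z \in vset H1 -> z \in vset H2 -> z = v.
  by move=> z1 z2; apply/set1P; rewrite -capV inE z1.
(* [vset H1] is closed under the edges of the deletion, so a walk from [x] to [y] would put [y] on
   both sides. *)
apply: contra nyv => xy; apply/eqP/meet => //; apply: joined_closed xV1 xy.
move=> e; rewrite inE => /andP[+ _]; rewrite DE => /setUP[eE|eE].
  by move=> _; rewrite /= -inc1 //; apply: subset_trans (subD1set _ _) (inc_sub eE).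
(* An edge of [H2] meets [vset H1] at most in [v], which has been removed. *)
case/pred0Pn=> z /=; rewrite !inE -inc2 // => /andP[/andP[nzv ze] z1].
by rewrite (meet z z1 (subsetP (inc_sub eE) z ze)) eqxx in nzv.
Qed.
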